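(* There is an algorithm that, given a split graph $G$ with $n$ vertices, decides in $O(n)$ time whether $G$ is $2$-admissible.
   Context: All graphs are finite and simple. A split graph is a graph whose vertex set can be partitioned into a clique $X$ and an independent set $Y$. A tree $t$-spanner of a graph $G$ is a spanning tree $T$ of $G$ such that $d_T(u,v)\le t$ for every edge $uv$ of $G$. $G$ is $t$-admissible if it has a tree $t$-spanner. *)

(* Defs.v *)
From mathcomp Require Import all_boot.

Set Implicit Arguments.
Unset Strict Implicit.
Unset Printing Implicit Defensive.

Section Graphs.
Variable V : finType.
Implicit Types (e f : rel V) (X Y : {set V}).

Definition simple_graph e : Prop := symmetric e /\ irreflexive e.

Definition is_clique e X : Prop := {in X &, forall u v, u != v -> e u v}.

Definition is_independent e Y : Prop := {in Y &, forall u v, ~~ e u v}.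

(* Either part may be empty. *)
Definition split_graph e : Prop :=
  exists X Y, [/\ X :|: Y = [set: V], [disjoint X & Y],
                  is_clique e X & is_independent e Y].

Definition has_walk e k u v : bool :=
  [exists p : k.-tuple V, path e u p && (last u p == v)].

(* Two vertices joined by a walk are joined by one of length < #|V|; the value
   #|V| is attained exactly when there is none. *)
Definition dist e u v : nat :=
  \big[minn/#|V|]_(k < #|V| | has_walk e k u v) k.

Definition connected_graph e : Prop := forall u v, connect e u v.

(* Duplicate-free cyclic sequences of length 2 are single edges walked back and
   forth, hence the bound 3. *)
Definition acyclic_graph e : Prop :=
  forall c : seq V, 3 <= size c -> uniq c -> ~~ cycle e c.

Definition is_tree e : Prop :=
  [/\ simple_graph e, connected_graph e & acyclic_graph e].

Definition spanning_tree e f : Prop := is_tree f /\ subrel f e.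

Definition tree_spanner t e f : Prop :=
  spanning_tree e f /\ forall u v, e u v -> dist f u v <= t.

Definition admissible t e : Prop := exists f, tree_spanner t e f.

End Graphs.

(* A word RAM with unit-cost instructions. Registers are named by constants of
   the program, so a program uses finitely many of them; memory cells are
   addressed through registers. With word size w, constants and sums are
   reduced modulo 2 ^ w, and subtraction is truncated at 0. *)
Inductive instr :=
| Const of nat & nat         (* Const r x    : r := x *)
| Add of nat & nat & nat     (* Add r a b    : r := a + b *)
| Sub of nat & nat & nat     (* Sub r a b    : r := a - b *)
| Read of nat & nat          (* Read r a     : r := memory[a] *)
| Write of nat & nat         (* Write a r    : memory[a] := r *)
| Jump of nat                (* Jump l       : goto l *)
| JumpEq of nat & nat & nat  (* JumpEq a b l : if a = b goto l *)
| JumpLt of nat & nat & nat  (* JumpLt a b l : if a < b goto l *)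
| Halt of bool.              (* Halt true accepts, Halt false rejects *)

Definition program := seq instr.

Record config := Config { pc : nat; reg : nat -> nat; mem : nat -> nat }.

Inductive outcome := Running of config | Halted of bool.

Definition upd (m : nat -> nat) (i x : nat) : nat -> nat :=
  fun j => if j == i then x else m j.

(* Running past the end of the program rejects. *)
Definition step (w : nat) (P : program) (s : config) : outcome :=
  let: Config l R M := s in
  let set r x := Running (Config l.+1 (upd R r x) M) in
  let goto l' := Running (Config l' R M) in
  match nth (Halt false) P l with
  | Const r x => set r (x %% 2 ^ w)
  | Add r a b => set r ((R a + R b) %% 2 ^ w)
  | Sub r a b => set r (R a - R b)
  | Read r a => set r (M (R a))
  | Write a r => Running (Config l.+1 R (upd M (R a) (R r)))
  | Jump l' => goto l'
  | JumpEq a b l' => goto (if R a == R b then l' else l.+1)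
  | JumpLt a b l' => goto (if R a < R b then l' else l.+1)
  | Halt b => Halted b
  end.

Fixpoint run (w : nat) (P : program) (t : nat) (s : config) : outcome :=
  if t is t'.+1 then
    match step w P s with
    | Running s' => run w P t' s'
    | Halted b => Halted b
    end
  else Running s.

(* The neighbours of each vertex are listed once each, in arbitrary order. *)
Definition adjacency_lists n (e : rel 'I_n) (adj : 'I_n -> seq 'I_n) : Prop :=
  forall v, uniq (adj v) /\ forall u, (u \in adj v) = e v u.

(* Memory layout of a graph on {0, ..., n-1}:
     cell 0            : n,
     cell 1 + v        : the degree of v,
     cell 1 + n + v    : the address at which the neighbours of v start,
     from cell 1 + 2 n : the neighbour lists of 0, ..., n-1, one after another.
   Degrees are stored because a bound O(n), which does not depend on the number
   of edges, leaves no time to traverse the lists. *)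
Definition encode n (adj : 'I_n -> seq 'I_n) : seq nat :=
  let lists := [seq [seq val u | u <- adj v] | v <- enum 'I_n] in
  n :: shape lists
    ++ [seq (n.*2).+1 + sumn (take v (shape lists)) | v <- iota 0 n]
    ++ flatten lists.

Definition init n (adj : 'I_n -> seq 'I_n) : config :=
  Config 0 (fun=> 0) (nth 0 (encode adj)).

(* P decides property Q on the graphs of class C within T n steps on n vertices.
   The constant k expresses the word size assumption w >= k log2 (n + 2): words
   of O(log n) bits suffice. *)
Definition decides_in_time (P : program) (C Q : forall n, rel 'I_n -> Prop)
    (T : nat -> nat) : Prop :=
  exists k, forall n (e : rel 'I_n) (adj : 'I_n -> seq 'I_n) (w : nat),
    simple_graph e -> C n e -> adjacency_lists e adj ->
    n.+2 ^ k <= 2 ^ w ->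
    exists b, run w P (T n) (init adj) = Halted b /\ (b <-> Q n e).

Definition bigO (f g : nat -> nat) : Prop :=
  exists c n0, forall n, n0 <= n -> f n <= c * g n.

(* Main.v *)
(* In a tree 2-spanner of a split graph with maximal clique X, the vertices of X
   induce a star with some centre c, and every other vertex with at least two
   neighbours must be adjacent to c. Conversely, if c is adjacent to all other
   vertices of degree at least 2 and no vertex is isolated, then the edges at c
   together with the pendant edges form a tree 2-spanner. This condition does
   not mention the partition, and it can be tested from the degrees alone: c is
   such a vertex iff deg c minus the number of pendant neighbours of c, plus 1
   if deg c > 1, equals the number of vertices of degree at least 2. Each
   pendant neighbour is found in constant time, as the only entry of its list. *)

Require Import Defs.
From mathcomp Require Import all_boot zify.

Set Implicit Arguments.
Unset Strict Implicit.
Unset Printing Implicit Defensive.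

(** * Tree 2-spanners of split graphs *)

Section Distance.
Variable V : finType.
Implicit Types (e f : rel V) (u v w : V).

Lemma bigminn_le (I : eqType) (r : seq I) (P : pred I) (F : I -> nat) N i :
  i \in r -> P i -> \big[minn/N]_(j <- r | P j) F j <= F i.
Proof.
elim: r => //= j r IHr; rewrite inE big_cons => /orP[/eqP <- -> | ir Pi].
  exact: geq_minl.
by case: ifP => _; [apply: leq_trans (geq_minr _ _) _|]; apply: IHr.
Qed.

Lemma dist_le_walk e u v k : has_walk e k u v -> dist e u v <= k.
Proof.
move=> walk; have [lt_k|le_k] := ltnP k #|V|.
  apply: (@bigminn_le _ _ _ (fun j : 'I_#|V| => val j) _ (Ordinal lt_k)) => //.
  exact: mem_index_enum.
(* The minimum never exceeds its default value [#|V|], whether or not a walk exists. *)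
apply: leq_trans le_k; rewrite /dist.
apply: (big_ind (fun d => d <= #|V|)) => // [x y lx _ | i _].
  by rewrite geq_min lx.
exact: ltnW.
Qed.

(** On at most two vertices the default value [#|V|] would meet the bound without any walk; hence
    the assumption on [#|V|]. *)
Lemma dist_le2P e u v : 2 < #|V| -> dist e u v <= 2 ->
  [\/ u = v, e u v | exists2 w, e u w & e w v].
Proof.
move=> V_gt2 d2; have [k le_k2 walk]: exists2 k, k <= 2 & has_walk e k u v.
  have: dist e u v < #|V| by apply: leq_ltn_trans d2 _.
  move: d2; rewrite /dist.
  elim/big_ind: _ => [|x y IHx IHy|k walk k2 _]; first by rewrite ltnn.
    by rewrite /minn; case: ifP.
  by exists k.
case: k le_k2 walk => [|[|[|//]]] _ /existsP[p].
- by rewrite tuple0 /= => /eqP ->; constructor 1.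
- case/tupleP: p => w p; rewrite tuple0 /= andbT => /andP[euw /eqP <-].
  by constructor 2.
case/tupleP: p => w p; case/tupleP: p => x p; rewrite tuple0 /= andbT.
by case/andP=> /andP[euw ewx] /eqP <-; constructor 3; exists w.
Qed.

End Distance.

(** * Short cycles in forests; sets pairwise within tree distance 2 *)

Section Forest.
Variables (V : finType) (f : rel V).
Hypotheses (f_simple : simple_graph f) (f_acyclic : acyclic_graph f).

Let symf : symmetric f := proj1 f_simple.
Let irrf : irreflexive f := proj2 f_simple.

Lemma adj_neq u v : f u v -> u != v.
Proof. by apply: contraTneq => ->; rewrite irrf. Qed.

Lemma forest_no_C3 a b c : f a b -> f b c -> f c a -> False.
Proof.
move=> ab bc ca; have := @f_acyclic [:: a; b; c] isT.
rewrite /= !inE !negb_or (adj_neq ab) (adj_neq bc) (eq_sym a c) (adj_neq ca) ab bc ca.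
by move=> /(_ isT).
Qed.

Lemma forest_no_C4 a b c d :
  f a b -> f b c -> f c d -> f d a -> a != c -> b != d -> False.
Proof.
move=> ab bc cd da ac bd; have := @f_acyclic [:: a; b; c; d] isT.
rewrite /= !inE !negb_or (adj_neq ab) (adj_neq bc) (adj_neq cd) (eq_sym a d).
by rewrite (adj_neq da) ac bd ab bc cd da => /(_ isT).
Qed.

(* Closed walks of odd length need no distinctness assumption: a repeated
   vertex would leave a triangle. *)
Lemma forest_no_C5 a b c d g :
  f a b -> f b c -> f c d -> f d g -> f g a -> False.
Proof.
move=> ab bc cd dg ga; have := @f_acyclic [:: a; b; c; d; g] isT.
rewrite /= !inE !negb_or (adj_neq ab) (adj_neq bc) (adj_neq cd) (adj_neq dg).
rewrite (eq_sym a g) (adj_neq ga) ab bc cd dg ga /=.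
have -> : a != c.
  by apply/eqP => eq_ac; apply: (@forest_no_C3 a d g) => //; rewrite eq_ac.
have -> : a != d.
  by apply/eqP => eq_ad; apply: (@forest_no_C3 a b c) => //; rewrite eq_ad.
have -> : b != d.
  by apply/eqP => eq_bd; apply: (@forest_no_C3 a b g) => //; rewrite eq_bd.
have -> : b != g.
  by apply/eqP => eq_bg; apply: (@forest_no_C3 b c d) => //; rewrite eq_bg.
have -> : c != g.
  by apply/eqP => eq_cg; apply: (@forest_no_C3 a b c) => //; rewrite eq_cg.
by move=> /(_ isT).
Qed.

Section SpannedClique.
Variable X : {set V}.
Hypothesis near_X : {in X &, forall a b,
  [\/ a = b, f a b | exists2 w, f a w & f w b]}.
Hypothesis non_neighbour : forall y, y \notin X -> exists2 x, x \in X & ~~ f x y.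

(** If [a] and [b] are joined only through some [w] outside [X], take [x] in [X] not adjacent to
    [w]. Unless [x] is adjacent to [a] or [b], its paths of length 2 to both close a cycle with
    [a w b]. *)
Lemma clique_tree_edge a b : a \in X -> b \in X -> a != b ->
  exists c d, [/\ c \in X, d \in X & f c d].
Proof.
move=> aX bX ab.
have [eq_ab|fab|[w faw fwb]] := near_X aX bX; first by rewrite eq_ab eqxx in ab.
  by exists a, b.
have [wX|wX] := boolP (w \in X); first by exists a, w.
have [x xX fxw] := non_neighbour wX.
have xw : x != w by apply: contraNneq wX => <-.
have xa : x != a by apply: contraNneq fxw => ->.
have xb : x != b by apply: contraNneq fxw => ->; rewrite symf.
have [fxa|nfxa] := boolP (f x a); first by exists x, a.
have [fxb|nfxb] := boolP (f x b); first by exists x, b.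
have [eq_xa||[z fxz fza]] := near_X xX aX; first by rewrite eq_xa eqxx in xa.
  by rewrite (negPf nfxa).
have [eq_xb||[z' fxz' fz'b]] := near_X xX bX; first by rewrite eq_xb eqxx in xb.
  by rewrite (negPf nfxb).
have zw : z != w by apply: contraNneq fxw => <-.
have z'w : z' != w by apply: contraNneq fxw => <-.
have z'a : z' != a by apply: contraNneq nfxa => <-.
have zb : z != b by apply: contraNneq nfxb => <-.
(* A common midpoint gives the 4-cycle [z a w b], distinct ones the 6-cycle [x z a w b z']. *)
exfalso; have [eq_z|zz'] := eqVneq z z'.
  apply: (@forest_no_C4 z a w b); rewrite // symf // eq_z //.
have := @f_acyclic [:: x; z; a; w; b; z'] isT.
rewrite /= !inE !negb_or xa xw xb zw zb zz' ab (adj_neq fxz) (adj_neq fxz') (adj_neq fza).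
rewrite (adj_neq faw) (adj_neq fwb) (eq_sym a z') z'a (eq_sym w z') z'w.
rewrite (eq_sym b z') (adj_neq fz'b) fxz fza faw fwb.
by rewrite (symf b) fz'b (symf z') fxz' => /(_ isT).
Qed.

(** Fix a tree edge [a b] inside [X]. Any other vertex of [X] hangs on [a] or [b], since otherwise a
    closed 5-walk arises. If some [x] hangs on [b] only, a vertex [y] hanging on [a] would close a
    4-cycle or 5-walk with [x], so [b] is the centre. *)
Lemma clique_tree_star : X != set0 ->
  exists2 c, c \in X & {in X, forall x, x != c -> f c x}.
Proof.
case/set0Pn=> u uX.
have [/existsP[v /andP[vX vu]]|/existsPn X1] := boolP [exists v, (v \in X) && (v != u)];
  last by exists u => // x xX xu; have := X1 x; rewrite xX xu.
have [a [b [aX bX fab]]] := clique_tree_edge vX uX vu.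
have fab_near x : x \in X -> x != a -> x != b -> f x a \/ f x b.
  move=> xX xa xb.
  have [eq_xa||[z fxz fza]] := near_X xX aX; first by rewrite eq_xa eqxx in xa.
    by left.
  have [eq_xb||[z' fxz' fz'b]] := near_X xX bX; first by rewrite eq_xb eqxx in xb.
    by right.
  by case: (@forest_no_C5 x z a b z'); rewrite // symf.
have [/forallP star_a|] := boolP [forall x, (x \in X) && (x != a) ==> f a x].
  by exists a => // x xX xa; have := star_a x; rewrite xX xa.
rewrite negb_forall => /existsP[x]; rewrite negb_imply.
case/andP=> /andP[xX xa] nfax.
have xb : x != b by apply: contraNneq nfax => ->.
have fxb : f x b by case: (fab_near x) => //; rewrite symf (negPf nfax).
exists b => // y yX yb; have [->|ya] := eqVneq y a; first by rewrite symf.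
have [fya|] := fab_near y yX ya yb; last by rewrite symf.
exfalso.
have [eq_xy|fxy|[z fxz fzy]] := near_X xX yX.
- by rewrite eq_xy symf fya in nfax.
- by apply: (@forest_no_C4 x y a b); rewrite // symf.
by apply: (@forest_no_C5 x z y a b); rewrite // symf.
Qed.

End SpannedClique.
End Forest.

(** * Characterisation of 2-admissible split graphs *)

Section TwoAdmissible.
Variables (V : finType) (e : rel V).
Hypothesis e_simple : simple_graph e.

Let syme : symmetric e := proj1 e_simple.
Let irre : irreflexive e := proj2 e_simple.

Lemma edge_degree_gt0 u v : e u v -> 0 < #|e u|.
Proof. by move=> euv; apply/card_gt0P; exists v. Qed.

Lemma degree_gt1P v :
  reflect (exists p q, [/\ e v p, e v q & p != q]) (1 < #|e v|).
Proof. exact: card_gt1P. Qed.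

Lemma degree1_uniq u v w : #|e u| = 1 -> e u v -> e u w -> v = w.
Proof.
move=> d1 euv euw; apply/eqP; apply: contraTT (leqnn 1) => vw.
by rewrite -{1}d1 -ltnNge; apply/degree_gt1P; exists v, w.
Qed.

(** The last clause makes the clique maximal. It is inherited by subgraphs and so yields
    [non_neighbour] for a spanning tree. *)
Definition maximal_split X :=
  [/\ is_clique e X, is_independent e (~: X)
    & forall y, y \notin X -> exists2 x, x \in X & ~~ e x y].

Lemma split_maximal : split_graph e -> exists X, maximal_split X.
Proof.
case=> X0 [Y0 [XYT XY0 clX0 inY0]].
pose P (X : {set V}) := [forall u in X, forall v in X, (u != v) ==> e u v]
  && [forall u in ~: X, forall v in ~: X, ~~ e u v].
have PP X : reflect (is_clique e X /\ is_independent e (~: X)) (P X).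
  apply: (iffP andP) => -[clX inX]; split.
  - by move=> u v uX vX; move/'forall_in_forall_inP/(_ u uX v vX)/implyP: clX.
  - by move=> u v uX vX; move/'forall_in_forall_inP/(_ u uX v vX): inX.
  - by apply/'forall_in_forall_inP => u uX v vX; apply/implyP/clX.
  - by apply/'forall_in_forall_inP => u uX v vX; apply/inX.
have /PP PX0 : P X0.
  apply/PP; split=> // u v; rewrite !inE => uX vX.
  have := in_setT u; have := in_setT v.
  by rewrite -XYT !inE (negPf uX) (negPf vX); apply/(fun a b => inY0 _ _ b a).
(* Take an inclusion-maximal clique with independent complement; a vertex adjacent to all of it
   could still be added. *)
have [X /maxsetP[/PP[clX inX] maxX] _] := maxset_exists (introT (PP X0) PX0).
exists X; split=> // y yX; apply/exists_inP; apply: contraNT yX.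
rewrite negb_exists_in => /forall_inP adj_y.
have exy x : x \in X -> e x y by move/adj_y; rewrite negbK.
rewrite -(maxX (y |: X)) ?subsetUr ?setU11 //; apply/PP; split=> u v.
  rewrite !inE => /orP[/eqP->|uX] /orP[/eqP->|vX] uv.
  - by rewrite eqxx in uv.
  - by rewrite syme exy.
  - by rewrite exy.
  - exact: clX.
rewrite !inE !negb_or => /andP[_ uX] /andP[_ vX].
by apply: inX; rewrite inE.
Qed.

Definition dominates_cycles c := forall v, v != c -> 1 < #|e v| -> e c v.

(** Let [c] be the centre of the star on the maximal clique. If [y] is not adjacent to [c], each
    edge [y z] is a tree edge, because a detour over [x] gives the triangle [c x z]. Two such edges
    form a 4-cycle through [c]. *)
Lemma admissible2_dominated : 1 < #|V| -> split_graph e -> admissible 2 e ->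
  exists c, dominates_cycles c.
Proof.
move=> V_gt1 /split_maximal[X [clX inX maxX]] [f [[[f_simple f_conn f_acyc] fe] f_span]].
(* With two vertices no degree exceeds 1, so any vertex serves as [c]. *)
have [V_gt2|V_le2] := ltnP 2 #|V|; last first.
  have /card_gt0P[c _] := ltnW V_gt1.
  exists c => v vc d_gt1.
  have : #|e v| < #|V|.
    rewrite -[#|V|](cardC (e v)) -addn1 leq_add2l; apply/card_gt0P.
    by exists v; rewrite inE /= unfold_in irre.
  by rewrite ltnNge (leq_trans V_le2).
have near u v : e u v -> [\/ u = v, f u v | exists2 w, f u w & f w v].
  by move/f_span; apply: dist_le2P.
have near_X : {in X &, forall u v, [\/ u = v, f u v | exists2 w, f u w & f w v]}.
  by move=> u v uX vX; have [->|/(clX u v uX vX)/near] := eqVneq u v; first by constructor 1.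
have X0 : X != set0.
  have /card_gt0P[v _] := ltnW V_gt1.
  apply/set0Pn; have [vX|/maxX[x xX _]] := boolP (v \in X); first by exists v.
  by exists x.
have maxXf y : y \notin X -> exists2 x, x \in X & ~~ f x y.
  by case/maxX=> x xX exy; exists x => //; apply: contra exy; apply: fe.
have [c cX star] := clique_tree_star f_simple f_acyc near_X maxXf X0.
have [symf irrf] := f_simple.
exists c => y yc /degree_gt1P[p [q [eyp eyq pq]]].
have [yX|yX] := boolP (y \in X); first by rewrite clX // eq_sym.
apply: contraT => ncy.
have in_X z : e y z -> z \in X.
  by move=> eyz; apply: contraTT eyz => zX; apply: inX; rewrite inE.
have adj_f z : e y z -> f y z && f c z.
  move=> eyz; have zc : z != c by apply: contraNneq ncy => <-; rewrite syme.
  have fcz := star z (in_X z eyz) zc; rewrite fcz andbT.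
  have [eq_yz||[x fyx fxz]] := near y z eyz => //.
    by rewrite eq_yz (in_X z) // -{1}eq_yz in yX.
  have xc : x != c by apply: contraNneq ncy => <-; rewrite syme fe.
  have fcx := star x (in_X x (fe _ _ fyx)) xc.
  by case: (@forest_no_C3 _ _ f_simple f_acyc c x z) => //; rewrite symf.
have [/andP[fyp fcp] /andP[fyq fcq]] := (adj_f p eyp, adj_f q eyq).
by case: (@forest_no_C4 _ _ f_simple f_acyc y p c q) => //; rewrite symf.
Qed.

Lemma connected_degree_gt0 v : 1 < #|V| -> connected_graph e -> 0 < #|e v|.
Proof.
move=> /card_gt1P[x [y [_ _ xy]]] conn.
have [w vw] : exists w, w != v.
  by have [<-|] := eqVneq x v; [exists y; rewrite eq_sym | exists x].
have /connectP[[|u p] /= ] := conn v w.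
  by move=> _ eq_wv; rewrite eq_wv eqxx in vw.
by case/andP=> /edge_degree_gt0.
Qed.

Lemma connected_sub (f : rel V) : subrel f e -> connected_graph f -> connected_graph e.
Proof.
by move=> fe conn u v; apply: connect_sub (conn u v) => x y /fe; apply: connect1.
Qed.

(** * The spanner formed by a star and pendant edges *)

Section Sufficiency.
Variable c : V.
Hypotheses (e_split : split_graph e) (deg_gt0 : forall v, 0 < #|e v|).
Hypothesis dom : dominates_cycles c.

Definition star_tree : rel V :=
  fun u v => e u v && [|| u == c, v == c, #|e u| == 1 | #|e v| == 1].

Lemma star_tree_sym : symmetric star_tree.
Proof. by move=> u v; rewrite /star_tree syme; do !case: (_ == _); rewrite ?orbT. Qed.

Lemma star_tree_simple : simple_graph star_tree.
Proof. by split; [apply: star_tree_sym | move=> u; rewrite /star_tree irre]. Qed.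

Lemma degree1_far v : v != c -> ~~ e c v -> #|e v| = 1.
Proof.
move=> vc; apply: contraNeq => d1; apply: dom => //.
by rewrite ltn_neqAle eq_sym d1 deg_gt0.
Qed.

(* Otherwise [u] and [v] would form a component of their own, which a split
   graph without isolated vertices only allows if there is no other vertex. *)
Lemma far_edge u v : u != c -> e u v -> ~~ e c u -> v != c -> e c v.
Proof.
move=> uc euv ncu vc; apply: contraT => ncv.
have [du dv] := (degree1_far uc ncu, degree1_far vc ncv).
have [X [Y [XYT XY0 clX inY]]] := e_split.
have XY x : x \in X \/ x \in Y by apply/setUP; rewrite XYT inE.
have /card_gt0P[z] := deg_gt0 c; rewrite unfold_in => ecz.
(* If [a] is in the clique, [c] is not, so its neighbour [z] is in the clique and is the only
   neighbour of [a]. Thus [b = z] is adjacent to [c]. *)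
have contra a b : a \in X -> a != c -> ~~ e c a -> e a b -> ~~ e c b ->
    #|e a| = 1 -> False.
  move=> aX ac nca eab ncb da.
  have [cX|cY] := XY c; first by rewrite clX // eq_sym in nca.
  have zX : z \in X by case: (XY z) => // zY; rewrite (negPf (inY c z cY zY)) in ecz.
  have za : a != z by apply: contraNneq nca => ->.
  by rewrite (degree1_uniq da eab (clX _ _ aX zX za)) ecz in ncb.
have [uX|uY] := XY u; first by case: (contra u v).
have [vX|vY] := XY v; first by case: (contra v u); rewrite // syme.
by rewrite (negPf (inY u v uY vY)) in euv.
Qed.

(** A vertex not adjacent to [c] is pendant, and its neighbour is adjacent to [c] by [far_edge]. *)
Lemma star_tree_connected : connected_graph star_tree.
Proof.
have to_c v : connect star_tree v c.
  have [->|vc] := eqVneq v c; first exact: connect0.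
  have [ecv|ncv] := boolP (e c v).
    by apply: connect1; rewrite /star_tree syme ecv eqxx orbT.
  have dv := degree1_far vc ncv.
  have /card_gt0P[u] := deg_gt0 v; rewrite unfold_in => evu.
  have uc : u != c by apply: contraNneq ncv => <-; rewrite syme.
  have ecu := far_edge vc evu ncv uc.
  apply: (@connect_trans _ _ u); apply: connect1; rewrite /star_tree.
    by rewrite evu dv eqxx !orbT.
  by rewrite syme ecu eqxx orbT.
move=> u v; apply: connect_trans (to_c u) _.
by rewrite (sym_connect_sym star_tree_sym).
Qed.

(** Rotate the cycle to start at [v]: the successor and the predecessor of [v] differ because the
    length is at least 3. *)
Lemma cycle_two_neighbours (f : rel V) s v : symmetric f ->
    3 <= size s -> uniq s -> cycle f s -> v \in s ->
  exists p q, [/\ p \in s, q \in s, f v p, f v q & p != q].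
Proof.
move=> symf s3 us cs /rot_to[i s' def_s'].
move: s3 us cs; rewrite -(size_rot i) -(rot_uniq i) -(rot_cycle i).
have in_s x : x \in v :: s' -> x \in s by rewrite -def_s' mem_rot.
rewrite def_s'; case: s' in_s {def_s'} => [|p [|r s']] // in_s _.
rewrite /= => /andP[_ /andP[pN _]] /and3P[fvp _].
rewrite rcons_path => /andP[_]; rewrite symf => fvq.
exists p, (last r s'); split=> //.
- by rewrite in_s // !inE eqxx orbT.
- by rewrite in_s // 2!in_cons mem_last !orbT.
by apply: contraNneq pN => ->; apply: mem_last.
Qed.

(** Vertices on a cycle are not pendant, so every edge of the cycle meets [c]; a cycle vertex other
    than [c] would have [c] as both of its neighbours. *)
Lemma star_tree_acyclic : acyclic_graph star_tree.
Proof.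
move=> s s3 us; apply/negP => cs.
have nbrs v := @cycle_two_neighbours _ s v star_tree_sym s3 us cs.
have deg v : v \in s -> #|e v| != 1.
  case/nbrs=> p [q [_ _ /andP[evp _] /andP[evq _] pq]].
  by rewrite neq_ltn; apply/orP; right; apply/degree_gt1P; exists p, q.
have [v vs vc] : exists2 v, v \in s & v != c.
  case: s s3 us {cs nbrs deg} => [|x [|y s]] //= _; rewrite inE negb_or.
  case/andP=> /andP[xy _] _; have [<-|xc] := eqVneq x c; last by exists x; rewrite ?inE ?eqxx.
  by exists y; rewrite ?inE ?eqxx ?orbT // eq_sym.
have eq_c p : p \in s -> star_tree v p -> p = c.
  move=> ps /andP[_]; rewrite (negPf vc) (negPf (deg v vs)) (negPf (deg p ps)).
  by rewrite !orbF => /eqP.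
have [p [q [ps qs vp vq]]] := nbrs v vs.
by rewrite (eq_c p) // (eq_c q) // eqxx.
Qed.

(** The ends of a non-tree edge differ from [c] and have degree at least 2, so the path through [c]
    joins them. *)
Lemma star_tree_spanner u v : e u v -> dist star_tree u v <= 2.
Proof.
move=> euv; have [tuv|ntuv] := boolP (star_tree u v).
  apply: leq_trans (isT : 1 <= 2); apply: dist_le_walk.
  by apply/existsP; exists [tuple v]; rewrite /= tuv eqxx.
apply: dist_le_walk; apply/existsP; exists [tuple c; v]; rewrite /= eqxx !andbT.
move: ntuv; rewrite /star_tree euv eqxx /= !negb_or orbT andbT.
case/and4P=> uc vc du dv.
by rewrite syme !dom // ltn_neqAle eq_sym ?du ?dv deg_gt0.
Qed.

Lemma dominated_admissible2 : admissible 2 e.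
Proof.
exists star_tree; split; last exact: star_tree_spanner.
split; last by move=> u v /andP[].
split; [exact: star_tree_simple | exact: star_tree_connected |].
exact: star_tree_acyclic.
Qed.

End Sufficiency.

Lemma admissible2P : 1 < #|V| -> split_graph e ->
  admissible 2 e <-> (forall v, 0 < #|e v|) /\ exists c, dominates_cycles c.
Proof.
move=> V_gt1 e_split; split=> [adm|[deg [c dom]]]; last exact: dominated_admissible2 dom.
split; last exact: admissible2_dominated.
move=> v; apply: connected_degree_gt0 => //.
by case: adm => f [[[_ conn _] fe] _]; apply: connected_sub conn.
Qed.

End TwoAdmissible.

(** * The program *)

Lemma run_le w P t t' s b :
  t <= t' -> run w P t s = Halted b -> run w P t' s = Halted b.
Proof.
elim: t t' s => [|t IHt] [|t'] s //= le_tt'.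
by case: (step w P s) => // s'; apply: IHt.
Qed.

(* Registers: 0 holds n, 1 holds 1, 2 is the loop counter, 3 counts the vertices
   of degree at least 2, 4 is the address of a table counting the pendant
   neighbours of each vertex, 9 holds 0, and 5 to 7 are scratch. The
   numbers in the margin are the addresses that the jumps refer to. *)
Definition spanner_program : program :=
  [:: (* 0 *) Const 1 1; Read 0 9; JumpLt 1 0 4; Halt true;
      (* 4 *) Read 4 0; Add 5 0 0; Read 6 5; Add 4 4 6;
      (* 8 *) JumpEq 2 0 23; Add 2 2 1; Read 6 2; JumpEq 6 9 36; JumpLt 1 6 21;
      (* 13 *) Add 5 2 0; Read 5 5; Read 5 5; Add 5 5 4; Read 6 5; Add 6 6 1;
      (* 19 *) Write 5 6; Jump 8;
      (* 21 *) Add 3 3 1; Jump 8;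
      (* 23 *) JumpEq 2 9 36; Add 5 4 2; Defs.Sub 5 5 1; Read 5 5; Read 6 2; Defs.Sub 7 6 5;
      (* 29 *) JumpLt 1 6 31; Jump 32; Add 7 7 1; JumpEq 7 3 35; Defs.Sub 2 2 1; Jump 23;
      (* 35 *) Halt true; Halt false].

Arguments upd m i x j /.

(** * Correctness and step counts of the two loops *)

Section Execution.
Variables (w n B : nat) (M0 : nat -> nat).

Let deg v := M0 v.+1.
Let first_nbr v := M0 (M0 (v.+1 + n)).
Let pendants v c := count (fun u => (deg u == 1) && (first_nbr u == c)) (iota 0 v).
Let branching v := count (fun u => 1 < deg u) (iota 0 v).
Let full c := deg c - pendants n c + (1 < deg c) == branching n.

Hypotheses (M0_size : M0 0 = n) (n_gt1 : 1 < n).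
(** In the encoding, cells [n] and [n + n] hold the degree of the last vertex and the start of its
    list, so [B] is the first address past the input. *)
Hypotheses (B_def : M0 n + M0 (n + n) = B) (B_gt : n + n < B).
Hypothesis M0_list : forall v, v < n -> deg v = 1 -> M0 (v.+1 + n) < B.
Hypothesis M0_nbr : forall v, v < n -> deg v = 1 -> first_nbr v < n.
Hypothesis deg_lt : forall v, v < n -> deg v < B.
Hypothesis M0_free : forall a, B <= a -> M0 a = 0.
(** [B + n] bounds every sum that the program forms, so no addition wraps around. *)
Hypothesis word : B + n < 2 ^ w.

(** Loop invariant of the scan. It holds initially because memory past the input is 0. *)
Definition table v M :=
  (forall a, a < B -> M a = M0 a) /\ (forall c, M (B + c) = pendants v c).

Definition registers i d (R : nat -> nat) :=
  [/\ R 0 = n, R 1 = 1, R 2 = i & [/\ R 3 = d, R 4 = B & R 9 = 0]].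

Lemma count_iota_le (p : pred nat) v : count p (iota 0 v) <= v.
Proof. by rewrite -{2}(size_iota 0 v) count_size. Qed.

Lemma count_iotaS (p : pred nat) v :
  count p (iota 0 v.+1) = count p (iota 0 v) + p v.
Proof. by rewrite -addn1 iotaD count_cat /= add0n addn0. Qed.

Lemma has_iotaS (p : pred nat) v :
  has p (iota 0 v.+1) = has p (iota 0 v) || p v.
Proof. by rewrite -addn1 iotaD has_cat /= add0n orbF. Qed.

(** Counter value [i] stands for vertex [i - 1], whose degree is in cell [i]. A round that continues
    takes 11 steps; the final jump and halt take 2. *)
Lemma run_search i R M : i <= n -> registers i (branching n) R -> table n M ->
  run w spanner_program (11 * i + 2) (Config 23 R M)
    = Halted (has full (iota 0 i)).
Proof.
elim: i R => [|i IHi] R le_in [R0 R1 R2 [R3 R4 R9]] [M_low M_high].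
  by rewrite /= R2 R9 /=.
have -> : 11 * i.+1 + 2 = (11 * i + 2).+3.+4.+4 by lia.
have Di : M (i.+1) = deg i by apply: M_low; lia.
have lt_word : B + i.+1 < 2 ^ w by lia.
have deg_i := deg_lt le_in.
rewrite has_iotaS.
rewrite /=.
rewrite R2 R9 /= R4 R1 R2 modn_small // addnS subn1 /= M_high Di.
have IH R' : registers i (branching n) R' -> forall t, 11 * i + 2 <= t ->
    run w spanner_program t (Config 23 R' M) = Halted (has full (iota 0 i)).
  by move=> regs t le_t; apply: run_le le_t (IHi _ (ltnW le_in) regs _).
case: ifP => D1 /=.
  rewrite R1 modn_small ?R3 /=; last lia.
  have -> : (deg i - pendants n i + 1 == branching n) = full i by rewrite /full D1.
  case: (full i); first by rewrite orbT.
  rewrite orbF /= R2 R1 subn1 /=; apply: IH => //; lia.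
rewrite R3.
have -> : (deg i - pendants n i == branching n) = full i by rewrite /full D1 addn0.
case: (full i); first by rewrite orbT.
rewrite orbF /= R2 R1 subn1 /=; apply: IH => //; lia.
Qed.

(** [k] vertices remain. A pendant vertex costs 13 steps, a branching one 7, and an isolated one
    rejects at once. Leaving the loop costs one step before the search. *)
Lemma run_scan k v R M : v + k = n -> registers v (branching v) R -> table v M ->
  run w spanner_program (13 * k + (11 * n + 3)) (Config 8 R M)
    = Halted (all (fun u => 0 < deg u) (iota v k) && has full (iota 0 n)).
Proof.
elim: k v R M => [|k IHk] v R M def_n regs tab.
  case: (regs) => [R0 R1 R2 [R3 R4 R9]]; rewrite addn0 in def_n.
  rewrite muln0 add0n addnS /= R2 R0 def_n eqxx.
  by apply: run_search; rewrite // -def_n.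
case: regs tab => [R0 R1 R2 [R3 R4 R9]] [M_low M_high].
have lt_vn : v < n by lia.
have -> : 13 * k.+1 + (11 * n + 3) = (13 * k + (11 * n + 3)).+4.+4.+4.+1 by lia.
have IH R' M' t : registers v.+1 (branching v.+1) R' -> table v.+1 M' ->
    13 * k + (11 * n + 3) <= t -> run w spanner_program t (Config 8 R' M') =
    Halted (all (fun u => 0 < deg u) (iota v.+1 k) && has full (iota 0 n)).
  by move=> regs tab le_t; apply: run_le le_t (IHk _ _ _ _ regs tab); lia.
have Dv : M v.+1 = deg v by apply: M_low; lia.
have v_word : v.+1 < 2 ^ w by lia.
have neq_vn := ltn_eqF lt_vn.
have [d0|d_gt0] := posnP (deg v).
  by rewrite /= R2 R0 neq_vn /= R2 R1 addn1 modn_small //= Dv R9 d0.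
have [d_gt1|d_le1] := ltnP 1 (deg v).
  apply: (@run_le _ _ (13 * k + (11 * n + 3)).+3.+4); first lia.
  rewrite /= R2 R0 neq_vn /= R2 R1 addn1 modn_small //= Dv R9 eqn0Ngt d_gt0 /= R1.
  rewrite d_gt1 /=; apply: IH; last lia.
    have b_le := count_iota_le (fun u => 1 < deg u) v.
    split=> //=; split=> //=.
    by rewrite R3 R1 modn_small /branching ?count_iotaS ?d_gt1 //; lia.
  split=> // c; rewrite M_high /pendants count_iotaS.
  by rewrite gtn_eqF ?addn0.
have d1 : deg v = 1 by lia.
have la := M0_list lt_vn d1; have ln := M0_nbr lt_vn d1.
rewrite /= R2 R0 neq_vn /= R2 R1 addn1 modn_small //= Dv R9 d1 /= R1 /= R0.
rewrite modn_small; last lia.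
rewrite (M_low (v.+1 + n)); last lia.
rewrite (M_low (M0 _)) // -/(first_nbr v) R4.
rewrite modn_small; last lia.
rewrite (addnC (first_nbr v)) M_high R1.
have p_le := count_iota_le (fun u => (deg u == 1) && (first_nbr u == first_nbr v)) v.
rewrite modn_small; last by rewrite /pendants; lia.
apply: IH; last lia.
  by split=> //=; split=> //=; rewrite R3 /branching count_iotaS d1 addn0.
split=> [a lt_a|c]; rewrite /upd.
  by rewrite ltn_eqF ?M_low //; lia.
rewrite eqn_add2l M_high /pendants count_iotaS d1 eqxx /= (eq_sym (first_nbr v)).
by have [->|_] := eqVneq c; rewrite ?addn0.
Qed.

Lemma run_spanner_program :
  run w spanner_program (24 * n + 10) (Config 0 (fun=> 0) M0)
    = Halted (all (fun u => 0 < deg u) (iota 0 n) && has full (iota 0 n)).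
Proof.
(* Seven initial instructions run before the scan. *)
have -> : 24 * n + 10 = (13 * n + (11 * n + 3)).+4.+3 by lia.
rewrite /= M0_size modn_small; last lia.
rewrite n_gt1 /= modn_small; last lia.
rewrite B_def modn_small; last lia.
apply: run_scan => //.
by split=> // c; rewrite M0_free // leq_addr.
Qed.

End Execution.

(** * Reading the encoded graph *)

Section Encoding.
Variables (n : nat) (adj : 'I_n -> seq 'I_n).

Let lists := [seq [seq val u | u <- adj v] | v <- enum 'I_n].
Let M0 := nth 0 (encode adj).

Lemma size_lists : size (shape lists) = n.
Proof. by rewrite /shape /lists 2!size_map size_enum_ord. Qed.

Lemma nth_lists (v : 'I_n) : nth [::] lists v = [seq val u | u <- adj v].
Proof. by rewrite /lists (nth_map v) ?size_enum_ord // nth_ord_enum. Qed.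

Lemma nth_shape_lists (v : 'I_n) : nth 0 (shape lists) v = size (adj v).
Proof.
have lt_v : v < size lists by rewrite -(size_map size) size_lists.
by rewrite (nth_map [::]) // nth_lists size_map.
Qed.

Lemma encode_degree (v : 'I_n) : M0 v.+1 = size (adj v).
Proof. by rewrite /M0 /encode /= nth_cat size_lists ltn_ord nth_shape_lists. Qed.

Lemma encode_start v : v < n ->
  M0 (v.+1 + n) = n.*2.+1 + sumn (take v (shape lists)).
Proof.
move=> lt_vn; rewrite /M0 /encode addSn /= nth_cat size_lists ltnNge leq_addl /=.
rewrite addnK nth_cat size_map size_iota lt_vn.
by rewrite (nth_map 0) ?size_iota // nth_iota.
Qed.

Lemma encode_list (v : 'I_n) i : i < size (adj v) ->
  M0 (M0 (v.+1 + n) + i) = nth 0 [seq val u | u <- adj v] i.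
Proof.
move=> lt_i; rewrite encode_start // /M0 /encode -addnA addSn /= nth_cat size_lists.
rewrite -addnn -addnA ltnNge leq_addr /= addKn nth_cat size_map size_iota.
rewrite ltnNge leq_addr /= addKn nth_flatten -/(flatten_index _ _ _).
by rewrite flatten_indexKl ?flatten_indexKr ?nth_shape_lists // nth_lists.
Qed.

Lemma size_encode : size (encode adj) = n.*2.+1 + sumn (shape lists).
Proof.
by rewrite /encode /= !size_cat size_lists size_map size_iota size_flatten addnA addnn.
Qed.

(** The last list starts after the sum of all other degrees; adding its own length reaches the end
    of the input. *)
Lemma encode_last : 0 < n -> M0 n + M0 (n + n) = size (encode adj).
Proof.
move=> n_gt0; have lt_n : n.-1 < n by rewrite prednK.
have := encode_start lt_n; have : M0 n.-1.+1 = nth 0 (shape lists) n.-1.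
  exact: etrans (encode_degree _) (esym (nth_shape_lists (Ordinal lt_n))).
rewrite prednK // => -> ->.
rewrite size_encode addnCA; congr (_ + _).
rewrite -{3}(cat_take_drop n.-1 (shape lists)) sumn_cat addnC.
rewrite (drop_nth 0) ?size_lists // prednK // drop_oversize ?size_lists //=.
by rewrite addn0.
Qed.

Lemma encode_free a : size (encode adj) <= a -> M0 a = 0.
Proof. exact: nth_default. Qed.

Lemma sumn_shape_le : (forall v, uniq (adj v)) -> sumn (shape lists) <= n * n.
Proof.
move=> uniq_adj; rewrite sumnE 2!big_map big_enum /=.
have -> : n * n = \sum_(v < n) n by rewrite sum_nat_const card_ord.
apply: leq_sum => v _; rewrite size_map.
by rewrite -(card_uniqP (uniq_adj v)) -[X in _ <= X]card_ord max_card.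
Qed.

End Encoding.

(** * From the computed answer to 2-admissibility *)

Section Decision.
Variables (n : nat) (e : rel 'I_n) (adj : 'I_n -> seq 'I_n).
Hypotheses (e_simple : simple_graph e) (adjP : adjacency_lists e adj).
Let M0 := nth 0 (encode adj).
Let deg v := M0 v.+1.
Let first_nbr v := M0 (M0 (v.+1 + n)).

Let syme : symmetric e := proj1 e_simple.
Let irre : irreflexive e := proj2 e_simple.

Lemma deg_card (v : 'I_n) : deg v = #|e v|.
Proof.
rewrite /deg /M0 encode_degree; have [uniq_adj mem_adj] := adjP v.
by rewrite -(card_uniqP uniq_adj); apply: eq_card => u; rewrite mem_adj.
Qed.

Lemma first_nbr_edge (v : 'I_n) : deg v = 1 ->
  exists2 u : 'I_n, first_nbr v = u & forall x, e v x = (x == u).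
Proof.
move=> d1; have d1' : size (adj v) = 1 by rewrite -encode_degree.
have [_ mem_adj] := adjP v.
have -> : first_nbr v = nth 0 [seq val u | u <- adj v] 0.
  by rewrite -encode_list ?d1' // addn0.
case: (adj v) d1' mem_adj => [|u [|? ?]] //= _ mem_adj.
by exists u => // x; rewrite -mem_adj inE.
Qed.

Lemma count_ord (p : pred nat) : count p (iota 0 n) = #|[pred v : 'I_n | p v]|.
Proof.
by rewrite -sum1_count -sum1_card -{1}[n]subn0 big_mkord; apply: eq_bigl.
Qed.

Lemma all_ord (p : pred nat) : all p (iota 0 n) = [forall v : 'I_n, p v].
Proof.
apply/allP/forallP => [p_all v|p_all v]; first by apply: p_all; rewrite mem_iota ltn_ord.
by rewrite mem_iota => lt_vn; apply: (p_all (Ordinal lt_vn)).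
Qed.

Lemma has_ord (p : pred nat) : has p (iota 0 n) = [exists v : 'I_n, p v].
Proof.
apply/hasP/existsP => [[v]|[v pv]]; last by exists (val v); rewrite ?mem_iota ?ltn_ord.
by rewrite mem_iota => lt_vn pv; exists (Ordinal lt_vn).
Qed.

Let pendants (c : nat) := count (fun u => (deg u == 1) && (first_nbr u == c)) (iota 0 n).
Let branching := count (fun u => 1 < deg u) (iota 0 n).

(** Without isolated vertices, the neighbours outside [A] are exactly the pendant ones. Removing
    them and cancelling [c] compares [A :&: N] with its superset [A :\ c]; equal sizes mean equal
    sets. *)
Lemma full_dominates (c : 'I_n) : (forall v, 0 < #|e v|) ->
  (deg c - pendants c + (1 < deg c) == branching) <-> dominates_cycles e c.
Proof.
move=> deg_gt0; pose A := [set v | 1 < #|e v|]; pose N := [set v | e c v].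
have -> : branching = #|A|.
  by rewrite /branching count_ord; apply: eq_card => v; rewrite !inE deg_card.
have -> : 1 < deg c = (c \in A) by rewrite inE deg_card.
have -> : deg c = #|N| by rewrite deg_card; apply: eq_card => v; rewrite !inE.
have -> : pendants c = #|N :\: A|.
  rewrite /pendants count_ord; apply: eq_card => v; rewrite !inE.
  rewrite -leqNgt -[#|e v| <= 1]andbT -(deg_gt0 v) -eqn_leq -deg_card.
  have [/first_nbr_edge[u -> ev]|//] := eqVneq (deg v) 1.
  by rewrite /= syme ev eq_sym.
have -> : #|N| - #|N :\: A| = #|A :&: N| by rewrite -(cardsID A N) addnK setIC.
have subN : A :&: N \subset A :\ c.
  apply/subsetP => v; rewrite !inE => /andP[-> ecv]; rewrite andbT.
  by apply: contraTneq ecv => ->; rewrite irre.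
rewrite [#|A|](cardsD1 c) addnC eqn_add2l (subset_leqif_cards subN).
split=> [/eqP eqN v vc d_gt1|dom].
  by have /setIP[_] : v \in A :&: N; rewrite ?eqN !inE ?vc.
rewrite eqEsubset subN; apply/subsetP => v; rewrite !inE.
by case/andP=> vc dv; rewrite dv dom.
Qed.

Lemma run_decides w : 1 < n -> split_graph e -> n.+2 ^ 2 <= 2 ^ w ->
  exists b, run w spanner_program (24 * n + 10) (init adj) = Halted b
    /\ (b <-> admissible 2 e).
Proof.
move=> n_gt1 e_split word; have n_gt0 := ltnW n_gt1.
have uniq_adj v := proj1 (adjP v).
have sum_le := sumn_shape_le uniq_adj.
have size_B := size_encode adj.
(* An empty list may start at the end of the input, but a list with one entry starts strictly before
   it. *)
have start_lt v : v < n -> deg v = 1 -> M0 (v.+1 + n) < size (encode adj).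
  move=> lt_vn dv; rewrite /M0 encode_start // size_B ltn_add2l.
  rewrite -{2}(cat_take_drop v (shape _)) sumn_cat -[X in X < _]addn0 ltn_add2l.
  rewrite (drop_nth 0) ?size_lists //= -[v]/(val (Ordinal lt_vn)) nth_shape_lists.
  by rewrite -encode_degree -/M0 /= -/(deg v) dv.
have deg_lt v : v < n -> deg v < size (encode adj).
  move=> lt_vn; rewrite -[v]/(val (Ordinal lt_vn)) deg_card.
  apply: leq_ltn_trans (max_card _) _; rewrite card_ord size_B; lia.
rewrite /init (@run_spanner_program w n (size (encode adj))) //.
- eexists; split; first by [].
  rewrite (admissible2P e_simple) ?card_ord // all_ord has_ord.
  split=> [/andP[/forallP pos /existsP[c full]]|[pos [c dom]]].
    have deg_gt0 v : 0 < #|e v| by rewrite -deg_card; apply: pos.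
    by split=> //; exists c; apply/(full_dominates c deg_gt0).
  apply/andP; split; first by apply/forallP => v; have := pos v; rewrite -deg_card.
  by apply/existsP; exists c; apply/(full_dominates c pos).
- exact: encode_last.
- rewrite size_B; lia.
- move=> v lt_vn dv; have [u def_u _] := @first_nbr_edge (Ordinal lt_vn) dv.
  by have : first_nbr v < n by rewrite [first_nbr v]def_u.
- exact: encode_free.
(* With at most [n * n] list entries, [B + n] is at most [n * n + 3 * n + 1], below [n.+2 ^ 2]. *)
apply: leq_trans word; rewrite size_B; lia.
Qed.
End Decision.

Lemma small_tree (n : nat) (e : rel 'I_n) :
  n <= 1 -> simple_graph e -> is_tree e.
Proof.
move=> n_le1 e_simple.
have eq_ord (u v : 'I_n) : u = v.
  by apply: ord_inj; have := ltn_ord u; have := ltn_ord v; lia.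
split=> // [u v|[|x [|y s]] // _ /=]; first by rewrite (eq_ord u v) connect0.
by rewrite (eq_ord x y) inE eqxx.
Qed.

Theorem theorem6 :
  exists (P : program) (T : nat -> nat),
    bigO T (fun n => n) /\
    decides_in_time P (fun n (e : rel 'I_n) => split_graph e)
                      (fun n (e : rel 'I_n) => admissible 2 e) T.
Proof.
exists spanner_program, (fun n => 24 * n + 10); split.
  by exists 34, 1 => n n_gt0; lia.
exists 2 => n e adj w e_simple e_split adjP word.
have [n_le1|n_gt1] := leqP n 1; last exact: run_decides word.
(* For [n <= 1] the fourth instruction accepts at once; the degree test would reject a single
   vertex. *)
exists true; split.
  apply: (@run_le _ _ 4); first lia.
  have w_word : 1 < 2 ^ w by lia.
  by rewrite /= modn_small // ltnNge n_le1.
(* The graph has no edges and is its own spanning tree. *)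
split=> // _; exists e; split; first by split=> //; apply: small_tree.
have [_ irre] := e_simple.
move=> u v; have -> : u = v.
  by apply: ord_inj; have := ltn_ord u; have := ltn_ord v; lia.
by rewrite irre.
Qed.
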